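(* Let $A$ be an algebraic $^*$-algebra. The following assertions are equivalent. (i) There exists a pre-$C^*$-norm on $A$. (ii) The involution of $A$ is proper. (iii) $A$ is hermitian and semisimple. (iv) Every non-zero selfadjoint $b\in A$ can be written as a finite sum $b=\sum_{j\in J}\lambda_j e_j$, where $(\lambda_j)_{j\in J}$ is a finite system of non-zero distinct real numbers and $(e_j)_{j\in J}$ is a finite system of non-zero (pairwise) orthogonal projections in $A$. (v) $A$ is a weakly Rickart $^*$-ring. (vi) $A$ is hermitian and von Neumann regular.
   Context: Rings and algebras are associative and not necessarily unital. A $^*$-algebra is a complex algebra $A$ with a map $^*:A\to A$ (involution) satisfying $(a^* )^*=a$, $(a+b)^*=a^*+b^*$, $(ab)^*=b^*a^*$, $(\lambda a)^*=\overline{\lambda}a^*$ for $a,b\in A$, $\lambda\in\mathbb{C}$. An algebra is algebraic if each of its elements generates a finite dimensional subalgebra (equivalently, is a root of a non-zero polynomial with coefficients in the field; zero constant term in the non-unital case). An element $a$ is selfadjoint if $a^*=a$. A projection is an element $e$ with $e=e^*=e^2$; projections $e,f$ are orthogonal if $ef=0$. A pre-$C^*$-norm on $A$ is a (possibly incomplete) submultiplicative norm $\sigma$ on $A$ with $\sigma(a^*a)=\sigma(a)^2$ for all $a\in A$. The involution of $A$ is proper if $a^*a=0$ implies $a=0$ for every $a\in A$. If $A$ has a unit $\mathbf{1}$, the spectrum of $a\in A$ is the set of $\lambda\in\mathbb{C}$ such that $\lambda\mathbf{1}-a$ has no inverse in $A$; if $A$ is non-unital, the spectrum of $a$ is the spectrum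 of $(0,a)$ in the standard unitization $A^1=\mathbb{C}\oplus A$. $A$ is hermitian if every selfadjoint element of $A$ has real spectrum. $A$ is semisimple if its Jacobson radical is $\{0\}$. $A$ is von Neumann regular if for every $a\in A$ there is $x\in A$ with $axa=a$. $A$ is a weakly Rickart $^*$-ring if for every $a\in A$ there is a projection $e\in A$ such that $ae=a$, and for every $y\in A$, $ay=0$ implies $ey=0$. *)

(* Defs.v *)
From HB Require Import structures.
From mathcomp Require Import all_boot all_order all_algebra.
From mathcomp Require Import all_classical reals.
From mathcomp Require Import complex.

Set Implicit Arguments.
Unset Strict Implicit.
Unset Printing Implicit Defensive.

Import Order.TTheory GRing.Theory Num.Theory.

Local Open Scope classical_set_scope.
Local Open Scope ring_scope.

(* The rings of ssralg are unital, so the product of a not necessarily unital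
   algebra is the semigroup product of monoid.v, written (a * b)%g. *)
HB.mixin Record Lmodule_isNonUnitalAlgebra (C : pzRingType) A
    of GRing.Lmodule C A & Semigroup A := {
  numulDl : forall a b c : A, ((a + b) * c)%g = (a * c)%g + (b * c)%g;
  numulDr : forall a b c : A, (a * (b + c))%g = (a * b)%g + (a * c)%g;
  numulZl : forall (l : C) (a b : A), ((l *: a) * b)%g = l *: (a * b)%g;
  numulZr : forall (l : C) (a b : A), (a * (l *: b))%g = l *: (a * b)%g
}.

#[short(type="nonUnitalAlgType")]
HB.structure Definition NonUnitalAlgebra (C : pzRingType) :=
  {A of GRing.Lmodule C A & Semigroup A & Lmodule_isNonUnitalAlgebra C A}.

HB.mixin Record NonUnitalAlgebra_isStar (C : numClosedFieldType) A
    of NonUnitalAlgebra C A := {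
  star : A -> A;
  starK : forall a : A, star (star a) = a;
  starD : forall a b : A, star (a + b) = star a + star b;
  starM : forall a b : A, star (a * b)%g = (star b * star a)%g;
  starZ : forall (l : C) (a : A), star (l *: a) = l^* *: star a
}.

#[short(type="starAlgType")]
HB.structure Definition StarAlgebra (C : numClosedFieldType) :=
  {A of NonUnitalAlgebra_isStar C A & NonUnitalAlgebra C A}.

Definition unitization (C : comPzRingType) (A : nonUnitalAlgType C) : Type :=
  (C^o * A)%type.

HB.instance Definition _ (C : comPzRingType) (A : nonUnitalAlgType C) :=
  GRing.Lmodule.on (unitization A).

Section Unitization.
Variables (C : comPzRingType) (A : nonUnitalAlgType C).

Definition unitization_mul (x y : unitization A) : unitization A :=
  (x.1 * y.1, x.1 *: y.2 + y.1 *: x.2 + (x.2 * y.2)%g).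

Lemma unitization_mulA : associative unitization_mul.
Proof.
move=> [k a] [l b] [m c]; congr pair; rewrite /= ?mulrA //.
rewrite !(scalerDr, numulDl, numulDr, numulZl, numulZr, scalerA) mulgA.
rewrite [m * k]mulrC [m * l]mulrC -!addrA.
congr (_ + _); congr (_ + _).
rewrite addrCA; congr (_ + _); rewrite [RHS]addrCA; congr (_ + _).
by rewrite addrCA.
Qed.

HB.instance Definition _ := hasMul.Build (unitization A) unitization_mul.
HB.instance Definition _ :=
  Magma_isSemigroup.Build (unitization A) unitization_mulA.

Lemma unitization_mulDl (x y z : unitization A) :
  ((x + y) * z)%g = (x * z)%g + (y * z)%g.
Proof.
case: x y z => [k a] [l b] [m c]; congr pair; first exact: mulrDl.
by rewrite /= scalerDl scalerDr numulDl [RHS]addrACA [X in _ = X + _]addrACA.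
Qed.

Lemma unitization_mulDr (x y z : unitization A) :
  (x * (y + z))%g = (x * y)%g + (x * z)%g.
Proof.
case: x y z => [k a] [l b] [m c]; congr pair; first exact: mulrDr.
by rewrite /= scalerDl scalerDr numulDr [RHS]addrACA [X in _ = X + _]addrACA.
Qed.

Lemma unitization_mulZl (l : C) (x y : unitization A) :
  ((l *: x) * y)%g = l *: (x * y)%g.
Proof.
case: x y => [k a] [m b]; congr pair; first by rewrite /= -mulrA.
by rewrite /= numulZl !scalerDr !scalerA [m * l]mulrC.
Qed.

Lemma unitization_mulZr (l : C) (x y : unitization A) :
  (x * (l *: y))%g = l *: (x * y)%g.
Proof.
case: x y => [k a] [m b]; congr pair; first exact: mulrCA.
by rewrite /= numulZr !scalerDr !scalerA [k * l]mulrC.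
Qed.

HB.instance Definition _ := Lmodule_isNonUnitalAlgebra.Build C (unitization A)
  unitization_mulDl unitization_mulDr unitization_mulZl unitization_mulZr.

End Unitization.

Section NonUnitalAlgebraTheory.
Variables (C : numClosedFieldType) (A : nonUnitalAlgType C).
Implicit Types (a e u x y : A) (I V : set A).

Definition linear_subspace V : Prop :=
  V 0 /\ forall (l : C) x y, V x -> V y -> V (l *: x + y).

Definition subalgebra V : Prop :=
  linear_subspace V /\ forall x y, V x -> V y -> V (x * y)%g.

Definition finite_dimensional V : Prop :=
  exists (n : nat) (v : 'I_n -> A),
    V = [set \sum_(i < n) c i *: v i | c in [set: 'I_n -> C]].

Definition algebraic : Prop :=
  forall a, finite_dimensional (smallest subalgebra [set a]).

Definition is_identity u : Prop := forall x, (u * x)%g = x /\ (x * u)%g = x.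

Definition has_identity : Prop := exists u, is_identity u.

Definition unital_spectrum a : set C :=
  [set l | exists2 u, is_identity u &
     ~ exists x, ((l *: u - a) * x)%g = u /\ (x * (l *: u - a))%g = u].

Definition left_ideal I : Prop :=
  linear_subspace I /\ forall a x, I x -> I (a * x)%g.

Definition modular I : Prop := exists u, forall x, I (x - (x * u)%g).

Definition maximal_modular_left_ideal I : Prop :=
  [/\ left_ideal I, modular I, I <> [set: A] &
      forall V, left_ideal V -> I `<=` V -> V <> [set: A] -> V = I].

(* The standard definition for algebras without unit; the intersection is all
   of A if there is no maximal modular left ideal. *)
Definition jacobson_radical : set A :=
  \bigcap_(I in [set I | maximal_modular_left_ideal I]) I.

Definition semisimple : Prop := jacobson_radical = [set 0].

Definition von_neumann_regular : Prop :=
  forall a, exists x, (a * x * a)%g = a.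

End NonUnitalAlgebraTheory.

Definition spectrum (C : numClosedFieldType) (A : nonUnitalAlgType C) (a : A) :
    set C :=
  [set l | (has_identity A /\ unital_spectrum a l) \/
           (~ has_identity A /\
              unital_spectrum ((0, a) : unitization A) l)].

Section StarAlgebraTheory.
Variables (C : numClosedFieldType) (A : starAlgType C).
Implicit Types (a e : A).

Definition selfadjoint a : Prop := star a = a.

Definition projection e : Prop := star e = e /\ (e * e)%g = e.

Definition proper_involution : Prop :=
  forall a, (star a * a)%g = 0 -> a = 0.

Definition hermitian_algebra : Prop :=
  forall a, selfadjoint a -> forall l : C, spectrum a l -> l \is Num.real.

Definition weakly_rickart : Prop :=
  forall a, exists e, [/\ projection e, (a * e)%g = a &
    forall y : A, (a * y)%g = 0 -> (e * y)%g = 0].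

End StarAlgebraTheory.

Arguments algebraic {C} A.
Arguments semisimple {C} A.
Arguments von_neumann_regular {C} A.
Arguments proper_involution {C} A.
Arguments hermitian_algebra {C} A.
Arguments weakly_rickart {C} A.

Record pre_Cstar_norm (R : realType) (A : starAlgType R[i]) (sigma : A -> R) :
    Prop := {
  pre_Cstar_ge0 : forall a : A, 0 <= sigma a;
  pre_Cstar_eq0 : forall a : A, sigma a = 0 -> a = 0;
  pre_Cstar_ler_add : forall a b : A, sigma (a + b) <= sigma a + sigma b;
  pre_Cstar_scale : forall (l : R[i]) (a : A),
    sigma (l *: a) = Normc.normc l * sigma a;
  pre_Cstar_submul : forall a b : A, sigma (a * b)%g <= sigma a * sigma b;
  pre_Cstar_identity : forall a : A, sigma (star a * a)%g = sigma a ^+ 2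
}.

Definition real_combination_of_projections
    (R : realType) (A : starAlgType R[i]) (b : A) : Prop :=
  exists (n : nat) (lambda : 'I_n -> R) (e : 'I_n -> A),
    [/\ injective lambda /\ (forall j, lambda j != 0),
        forall j, projection (e j) /\ e j != 0,
        forall j k, j != k -> (e j * e k)%g = 0 &
        b = \sum_(j < n) (lambda j)%:C%C *: e j].

(* Main.v *)
Require Import Defs.
From mathcomp Require Import all_boot all_order all_algebra.
From mathcomp Require Import all_classical reals.
From mathcomp Require Import complex ring.

(** Everything is reduced to one statement about selfadjoint elements: each
non-zero selfadjoint [h] has a non-zero real eigenvalue [l] together with a
projection [f] onto the whole [l]-eigenspace [{u | h u = l u}]
([enough_eigenprojections]).

A proper involution gives this ([proper_eigenprojections]).  As [h] is
algebraic, some product of shifts [h - l] kills [h]; stopping one factor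
earlier yields [v <> 0], a polynomial in [h], with [h v = l v].  Then [v^* v]
is a non-zero selfadjoint eigenvector of [h], and a multiple of it is the
projection.  Splitting off one eigenprojection removes one root of an
annihilating polynomial of [h], so the spectral theorem (iv) follows by
induction ([eigen_spectral_theorem]).  Conversely eigenprojections make the
involution proper, because a normal [a <> 0] has a vector [y <> 0] with
[a^* a y = l y], [l > 0]: take a joint eigenvector of its real and imaginary
parts ([normal_eigenvector], [eigen_proper]).

The properties (v) and (vi), together with the semisimplicity in (iii), are
read off the decomposition of [a^* a], or of [h] in the case of hermitian.
For the way back from hermitian algebras, [b^* b = 0] implies
[(1 + b^* )(1 - b) = 1 - (b - b^* )], whose right-hand side is invertible as
[i (b - b^* )] is selfadjoint.  So [1 - b] is left invertible.  When
[a^* a = 0] this applies to every [b = a x], hence every [1 - x a] is left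
invertible, which puts [a] into the Jacobson radical
([hermitian_semisimple_proper]) and forbids the idempotent [x a] to be
non-zero if [a x a = a] ([hermitian_regular_proper]).

The pre-C*-norm needs positivity.  The crux is that [b^* b = - p] with a
projection [p = p^* = p^2] and [b p = b] forces [p = 0]
([no_negative_square]): properness makes [p q p], where [q = - b b^*] is a
projection, positive and invertible in the corner [p A p], and rescaling [b] by
its inverse square root yields [c] in that corner with [c c^* = - p].  Algebraic
algebras are Dedekind finite, so [c^* c = - p] as well, [c] is normal, and the
eigenvector of [c^* c] is a contradiction.  Therefore every [a^* a] has
non-negative eigenvalues, the elements [c^* c] form a convex cone that contains
no line ([psdD], [psd_anti]), and [A] acts on itself by left multiplication as
on a Hilbert module with the inner product [x^* y].  The operator norm, the
infimum of the [t > 0] with [(a x)^* (a x) <= t^2 x^* x] for all [x], is the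
required norm ([operator_norm_Cstar]); it is finite since a projection has norm
  at most [1]
and [a^* a] is a combination of projections. *)

Set Implicit Arguments.
Unset Strict Implicit.
Unset Printing Implicit Defensive.

Import Order.TTheory GRing.Theory Num.Theory.

Local Open Scope classical_set_scope.
Local Open Scope ring_scope.

Local Notation "a ** b" := (a * b)%g (at level 40, left associativity).

(** * Algebras without unit *)

Section NonUnital.
Variables (C : numClosedFieldType) (A : nonUnitalAlgType C).
Implicit Types (a b h u v x y f : A) (l m : C) (s : seq C).

Lemma numul0l a : 0 ** a = 0.
Proof. by have := numulZl 0 0 a; rewrite !scale0r. Qed.

Lemma numul0r a : a ** 0 = 0.
Proof. by have := numulZr 0 a 0; rewrite !scale0r. Qed.

Lemma numulNl a b : - a ** b = - (a ** b).
Proof. by rewrite -scaleN1r numulZl scaleN1r. Qed.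

Lemma numulNr a b : a ** - b = - (a ** b).
Proof. by rewrite -scaleN1r numulZr scaleN1r. Qed.

Lemma numulBl a b x : (a - b) ** x = a ** x - b ** x.
Proof. by rewrite numulDl numulNl. Qed.

Lemma numulBr a b x : a ** (b - x) = a ** b - a ** x.
Proof. by rewrite numulDr numulNr. Qed.

Lemma numul_suml n (F : 'I_n -> A) x :
  (\sum_(i < n) F i) ** x = \sum_(i < n) F i ** x.
Proof.
by apply: (big_morph (fun y => y ** x)) => [a b|]; rewrite ?numulDl ?numul0l.
Qed.

Lemma numul_sumr n (F : 'I_n -> A) x :
  x ** (\sum_(i < n) F i) = \sum_(i < n) x ** F i.
Proof.
by apply: (big_morph (fun y => x ** y)) => [a b|]; rewrite ?numulDr ?numul0r.
Qed.

Definition numulE :=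
  (@numulDl C A, @numulDr C A, numulNl, numulNr, @numulZl C A, @numulZr C A,
   numul0l, numul0r).

(** [(h - l_1) ... (h - l_n) u] for [s = l_1, ..., l_n]: a polynomial in [h],
given by its roots, acting on [u].  No unit of [A] is involved. *)
Definition shifts h s u : A := foldr (fun l v => h ** v - l *: v) u s.

Lemma shifts_cons h l s u :
  shifts h (l :: s) u = h ** shifts h s u - l *: shifts h s u.
Proof. by []. Qed.

Lemma shiftsB h s u v : shifts h s (u - v) = shifts h s u - shifts h s v.
Proof.
elim: s => //= l s ->; rewrite numulBr scalerBr !opprB addrACA [RHS]addrACA.
by rewrite [- _ + _]addrC.
Qed.

Lemma shifts_numul h s u x : shifts h s (u ** x) = shifts h s u ** x.
Proof. by elim: s => //= l s ->; rewrite numulBl mulgA numulZl. Qed.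

Lemma shifts_comm h s u : h ** u = u ** h ->
  h ** shifts h s u = shifts h s u ** h.
Proof.
move=> hu; elim: s => //= l s IH.
by rewrite numulBr numulBl numulZr numulZl -IH -mulgA -IH.
Qed.

Lemma shifts_eigen h s l u : h ** u = l *: u ->
  shifts h s u = (\prod_(m <- s) (l - m)) *: u.
Proof.
move=> hu; elim: s => [|m s IH] /=; first by rewrite big_nil scale1r.
rewrite IH big_cons numulZr hu !scalerA -scalerBl; congr (_ *: _).
by rewrite mulrBl [X in X - _]mulrC.
Qed.

(** The factors commute, so any root can be brought to the front. *)
Lemma shifts_rem h s l u : l \in s ->
  shifts h s u = shifts h (l :: rem l s) u.
Proof.
elim: s => //= m s IH; rewrite inE eq_sym; have [-> //|/= _ ls] := eqVneq m l.
rewrite IH //= !numulBr !numulZr !scalerBr !scalerA [l * m]mulrC !opprB.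
by rewrite addrACA [RHS]addrACA [- _ - _]addrC.
Qed.

(** The power [a^(i+1)]; the exponent [0] has no meaning without a unit. *)
Definition succ_power a i : A := iter i (fun x => a ** x) a.

Definition power_sum a (p : {poly C}) : A :=
  \sum_(i < size p) p`_i *: succ_power a i.

Lemma power_sumE a n (p : {poly C}) : (size p <= n)%N ->
  power_sum a p = \sum_(i < n) p`_i *: succ_power a i.
Proof.
move=> pn; rewrite /power_sum (big_ord_widen _ (fun i => p`_i *: succ_power a
  i) pn).
rewrite big_mkcond /=; apply: eq_bigr => i _; case: ltnP => // pi.
by rewrite nth_default ?scale0r.
Qed.

Lemma power_sumZ a l (p : {poly C}) : power_sum a (l *: p) = l *: power_sum a p.
Proof.
rewrite (power_sumE a (size_scale_leq l p)) scaler_sumr.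
by apply: eq_bigr => i _; rewrite coefZ scalerA.
Qed.

Lemma power_sum_shift a l (p : {poly C}) :
  power_sum a (('X - l%:P) * p) = a ** power_sum a p - l *: power_sum a p.
Proof.
have szp : (size (('X - l%:P) * p)%R <= (size p).+1)%N.
  by rewrite (leq_trans (size_polyMleq _ _)) // size_XsubC.
rewrite (power_sumE a szp) numul_sumr scaler_sumr.
under eq_bigr do rewrite mulrBl coefB coefXM coefCM scalerBl.
rewrite sumrB big_ord_recl /= scale0r add0r; congr (_ - _).
  by apply: eq_bigr => i _; rewrite numulZr.
rewrite big_ord_recr /= [p`__]nth_default // mulr0 scale0r addr0.
by apply: eq_bigr => i _; rewrite scalerA.
Qed.

Lemma power_sum_roots a s :
  power_sum a (\prod_(l <- s) ('X - l%:P)) = shifts a s a.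
Proof.
elim: s => [|l s IH]; last by rewrite big_cons power_sum_shift IH.
by rewrite big_nil /power_sum size_poly1 big_ord1 coef1 scale1r.
Qed.

(** The [n+1] powers [a, ..., a^(n+1)] lie in the span of [n] vectors, which
gives a non-zero [p] with [a p(a) = 0]; the scalars being algebraically closed,
[p] is a product of linear factors. *)
Lemma algebraic_shifts a : finite_dimensional (smallest (@subalgebra C A) [set
  a]) ->
  exists s, shifts a s a = 0.
Proof.
move=> [n [v defV]]; pose x i := succ_power a i.
have Vx i : smallest (@subalgebra C A) [set a] (x i).
  move=> V [[_ Vm] aV]; elim: i => [|i IH]; first exact: aV.
  by apply: Vm => //; exact: aV.
have /choice[c xc] i : exists c : 'I_n -> C, x i = \sum_(j < n) c j *: v j.
  by move: (Vx i); rewrite defV => -[c _ <-]; exists c.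
pose M : 'M_(n.+1, n) := \matrix_(i, j) c i j.
have : kermx M != 0.
  by rewrite kermx_eq0 /row_free ltn_eqF // ltnS rank_leq_col.
case/rowV0Pn => k /sub_kermxP kM k0.
pose p := \poly_(i < n.+1) k 0 (inord i).
have p0 : p != 0.
  apply: contra_neq k0 => p0; apply/rowP => i; rewrite mxE.
  by move: (congr1 (fun q : {poly C} => q`_i) p0);
    rewrite coef_poly ltn_ord inord_val coef0.
have [s ps] := closed_field_poly_normal p; exists s.
suff : power_sum a p = 0.
  rewrite ps power_sumZ power_sum_roots => /eqP;
    rewrite scaler_eq0 lead_coef_eq0.
  by rewrite (negPf p0) => /eqP.
rewrite (power_sumE a (size_poly _ _)).
have -> : \sum_(i < n.+1) p`_i *: succ_power a i =
    \sum_(i < n.+1) k 0 i *: \sum_(j < n) M i j *: v j.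
  apply: eq_bigr => i _; rewrite coef_poly ltn_ord inord_val; congr (_ *: _).
  by rewrite -/(x i) xc; apply: eq_bigr => j _; rewrite mxE.
under eq_bigr do rewrite scaler_sumr.
rewrite exchange_big /= big1 // => j _.
under eq_bigr do rewrite scalerA.
rewrite -scaler_suml; move/rowP/(_ j): kM; rewrite !mxE => ->.
by rewrite scale0r.
Qed.

(** If [1 + y] is a left inverse of [1 - a x], then [1 + x (1 + y) a] is one of
[1 - x a].  [y - y b = b] says [(1 + y)(1 - b) = 1] without using the unit. *)
Lemma quasi_regular_swap a x : (exists y, y - y ** (a ** x) = a ** x) ->
  exists y, y - y ** (x ** a) = x ** a.
Proof.
move=> [y yE]; exists (x ** a + x ** y ** a).
rewrite numulDl opprD addrACA -addrA; apply/eqP; rewrite -[eqbRHS]addr0.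
rewrite (inj_eq (addrI _)) addrA -[X in _ + X - _]mulgA -[x ** y ** a **
  _]mulgA.
rewrite -[x ** y ** _]mulgA [a ** (x ** a)]mulgA [y ** (_ ** a)]mulgA.
rewrite -[x ** a ** _]mulgA [a ** (x ** a)]mulgA.
by rewrite -addrA -numulBr -numulBl yE addNr.
Qed.

Lemma left_idealD (I : set A) x y : left_ideal I -> I x -> I y -> I (x + y).
Proof. by move=> [[_ Ilin] _] Ix Iy; rewrite -[x]scale1r; exact: Ilin. Qed.

(** If [a] avoids a maximal modular left ideal [I] with right unit [u] modulo
[I], then [I + A a] is everything, so [u = w + z a] with [w] in [I].  With
[y - y (z a) = z a], the element [z a = (y - y u) + y w] lies in [I], and then
so does [u]. *)
Lemma quasi_regular_radical a :
  (forall x, exists y, y - y ** (x ** a) = x ** a) -> jacobson_radical a.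
Proof.
move=> qr I [idI [u Iu] IT maxI]; have [[I0 Ilin] Imul] := idI.
have uI : ~ I u.
  move=> Iu'; apply: (IT); apply/seteqP; split=> // x _.
  by rewrite -(subrK (x ** u) x); apply: left_idealD => //; exact: Imul.
apply: contrapT => Ia.
(* [J] takes care of the case [A a <= I], where [I + A a] is only [I]. *)
pose J : set A := [set y | forall x, I (x ** y)].
have JI : J = I.
  apply: maxI => [|y Iy x|JT]; last 2 first.
  - exact: Imul.
  - apply: (IT); apply/seteqP; split=> // x _.
    have Ju : J u by rewrite JT.
    by rewrite -(subrK (x ** u) x); apply: left_idealD => //; exact: Ju.
  - split; first split=> [x|l y z Jy Jz x].
    + by rewrite numul0r.
    + by rewrite numulDr numulZr; apply: Ilin; [exact: Jy | exact: Jz].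
    + by move=> z y Jy x; rewrite mulgA; exact: Jy.
have [x Ixa] : exists x, ~ I (x ** a).
  by apply/existsNP => Ja; apply: Ia; rewrite -JI.
pose V : set A := [set v | exists w z, I w /\ v = w + z ** a].
have VT : V = [set: A].
  apply: contrapT => VT; apply: Ixa; rewrite -(maxI V) //.
  - by exists 0, x; rewrite add0r.
  - split; first split.
    + by exists 0, 0; rewrite numul0l addr0.
    + move=> l _ _ [m [z [Im ->]]] [m' [z' [Im' ->]]].
      exists (l *: m + m'), (l *: z + z'); split; first exact: Ilin.
      by rewrite scalerDr numulDl numulZl addrACA.
    + move=> y _ [m [z [Im ->]]]; exists (y ** m), (y ** z).
      by split; [exact: Imul | rewrite numulDr mulgA].
  - by move=> m Im; exists m, 0; rewrite numul0l addr0.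
have [m [z [Im uE]]] : V u by rewrite VT.
have [y yE] := qr z.
apply: uI; rewrite uE; apply: left_idealD => //.
rewrite -yE -(subrK (y ** m) (y - _)); apply: left_idealD => //;
  last exact: Imul.
by rewrite -addrA -opprD addrC [_ + y ** m]addrC -numulDr -uE addrC; exact: Iu.
Qed.

(** By Zorn's lemma there is a left ideal maximal among those that contain
[A (1 - f)] and avoid [f].  It is modular with right unit [f], and maximal among
all proper left ideals, as a left ideal containing [A (1 - f)] and [f] is
everything. *)
Lemma idempotent_notin_radical f : f ** f = f -> f != 0 ->
  ~ jacobson_radical f.
Proof.
move=> ff /eqP f0 radf; pose K : set A := [set x | x ** f = 0].
have K0 : K 0 by exact: numul0l.
have Klin l x y : K x -> K y -> K (l *: x + y).
  by move=> Kx Ky; rewrite /K /= numulDl numulZl Kx Ky scaler0 addr0.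
have Kmul a x : K x -> K (a ** x).
  by move=> Kx; rewrite /K /= -mulgA Kx numul0r.
(* Adding [K] here makes the union of the empty chain admissible. *)
pose P (B : set A) := left_ideal (B `|` K) /\ ~ (B `|` K) f.
have [F FP Ftot|B [[idB fB] maxB]] := Zorn_bigcup (P := P).
  split; last first.
    move=> [[X FX Xf]|Kf]; first by apply: (FP X FX).2; left.
    by apply: f0; rewrite -ff.
  have up X : F X -> X `|` K `<=` (\bigcup_(X in F) X) `|` K.
    by move=> FX x [Xx|Kx]; [left; exists X | right].
  split; first split.
  - by right.
  - move=> l x y; have sub X : F X -> (X `|` K) x -> (X `|` K) y ->
        (\bigcup_(X in F) X `|` K) (l *: x + y).
      by move=> FX Xx Xy; apply: (up X FX); apply: (FP X FX).1.1.2.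
    move=> [[X FX Xx]|Kx] [[Y FY Yy]|Ky].
    + have [XY|YX] := Ftot X Y FX FY.
        by apply: (sub Y) => //; left => //; exact: XY.
      by apply: (sub X) => //; left => //; exact: YX.
    + by apply: (sub X) => //; [left | right].
    + by apply: (sub Y) => //; [right | left].
    + by right; exact: Klin.
  - move=> a x [[X FX Xx]|Kx]; last by right; exact: Kmul.
    by apply: (up X FX); apply: (FP X FX).1.2; left.
apply: (fB); apply: radf; split=> //.
- by exists f => x; right; rewrite /K /= numulBl -mulgA ff subrr.
- by move=> BT; apply: fB; rewrite BT.
move=> V idV BV VT; apply: contrapT => VB.
have KV : K `<=` V by move=> x Kx; apply: BV; right.
have VK : V `|` K = V by apply/setUidPl.
apply: (maxB V).
  split=> [x Bx|VsubB]; first by apply: BV; left.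
  by apply: (VB); apply/seteqP; split=> // x Vx; left; exact: VsubB.
split; rewrite VK // => Vf; apply: VT; apply/seteqP; split=> // x _.
rewrite -(subrK (x ** f) x); apply: left_idealD => //; last exact: idV.2.
by apply: KV; rewrite /K /= numulBl -mulgA ff subrr.
Qed.

Definition unitization_one : unitization A := (1, 0).

Lemma unitization_identity : is_identity unitization_one.
Proof.
move=> [l a]; split; congr pair; rewrite /= ?mul1r ?mulr1 //.
  by rewrite scale1r scaler0 numul0l !addr0.
by rewrite scale1r scaler0 numul0r add0r addr0.
Qed.

Lemma identity_unique (B : nonUnitalAlgType C) (u v : B) :
  is_identity u -> is_identity v -> u = v.
Proof. by move=> iu iv; rewrite -(iv u).1 (iu v).2. Qed.

Lemma unitization_mulE (k l : C) x y :
  ((k, x) : unitization A) ** (l, y) = (k * l, k *: y + l *: x + x ** y).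
Proof. by []. Qed.

Lemma unitization_shiftE l a : l *: unitization_one - (0, a) = (l, - a).
Proof.
by congr pair; rewrite /= ?scaler0 ?sub0r // subr0; exact: mulr1.
Qed.

(** The inverse of [l - a] in the unitization has the form [l^-1 + z] with [z]
in [A]; the equations for [z] make sense in [A] and are the same whether or not
[A] has a unit. *)
Lemma quasi_invertible_notin_spectrum a l : l != 0 ->
    (exists z, l *: z - a ** z = l^-1 *: a /\ l *: z - z ** a = l^-1 *: a) ->
  ~ spectrum a l.
Proof.
move=> l0 [z [az za]] [[_ [u iu]]|[_ [u iu]]]; apply.
  exists (l^-1 *: u + z); rewrite !numulE (iu u).1 (iu a).1 (iu a).2 (iu z).1.
  rewrite (iu z).2 !scalerA mulfV // mulVf // scale1r; split.
    have -> : l *: z = l^-1 *: a + a ** z by rewrite -az subrK.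
    by rewrite -opprD addrK.
  by rewrite za subrK.
rewrite (identity_unique iu unitization_identity) unitization_shiftE.
exists (l^-1, z); rewrite !unitization_mulE mulfV // mulVf //; split;
  congr pair.
  by rewrite scalerN numulNl addrAC az subrr.
by rewrite scalerN numulNr -addrA za addNr.
Qed.

Lemma notin_spectrum_quasi_invertible a l : l != 0 -> ~ spectrum a l ->
  exists z, l *: z - z ** a = l^-1 *: a.
Proof.
move=> l0 al; have [[u iu]|noid] := pselect (has_identity A).
  have [x [_ xE]] : exists x, (l *: u - a) ** x = u /\ x ** (l *: u - a) = u.
    by apply: contrapT => nx; apply: al; left; split; exists u.
  exists (x - l^-1 *: u); move: xE; rewrite numulBr numulZr (iu x).2 => xE.
  rewrite scalerBr scalerA mulfV // scale1r numulBl numulZl (iu a).1 opprB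
    addrACA.
  by rewrite (AC (2*2) ((1*4)*(2*3))) /= xE addrC subrK.
have [[k z] [_]] : exists x : unitization A,
    (l *: unitization_one - (0, a)) ** x = unitization_one /\
    x ** (l *: unitization_one - (0, a)) = unitization_one.
  apply: contrapT => nx; apply: al; right; split=> //.
  by exists unitization_one => //; exact: unitization_identity.
rewrite unitization_shiftE unitization_mulE => -[kl zE]; exists z.
have -> : l^-1 = k by rewrite -[k]mulr1 -(mulfV l0) mulrA kl mul1r.
by move/eqP: zE; rewrite scalerN numulNr -addrA addrC subr_eq0 => /eqP.
Qed.

End NonUnital.

(** * Eigenprojections of selfadjoint elements *)

Section Star.
Variables (C : numClosedFieldType) (A : starAlgType C).
Implicit Types (a b c f g h p q u v w x y z : A) (l m : C) (s : seq C).

Lemma star0 : star (0 : A) = 0.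
Proof. by have := starZ 0 (0 : A); rewrite conjC0 !scale0r. Qed.

Lemma starN a : star (- a) = - star a.
Proof. by rewrite -scaleN1r starZ rmorphN rmorph1 scaleN1r. Qed.

Lemma starB a b : star (a - b) = star a - star b.
Proof. by rewrite starD starN. Qed.

Lemma star_sum n (F : 'I_n -> A) :
  star (\sum_(i < n) F i) = \sum_(i < n) star (F i).
Proof. by apply: big_morph; [exact: starD | exact: star0]. Qed.

Lemma starZ_real l a : l \is Num.real -> star (l *: a) = l *: star a.
Proof. by move=> lR; rewrite starZ conj_Creal. Qed.

Lemma selfadjoint_starM a : selfadjoint (star a ** a).
Proof. by rewrite /selfadjoint starM starK. Qed.

Lemma scale_inj l m u : u != 0 -> l *: u = m *: u -> l = m.
Proof.
move=> u0 /eqP; rewrite -subr_eq0 -scalerBl scaler_eq0 (negPf u0) orbF.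
by rewrite subr_eq0 => /eqP.
Qed.

Lemma star_shifts h s : selfadjoint h ->
  star (shifts h s h) = shifts h (map Num.conj s) h.
Proof.
move=> hh; elim: s => //= l s IH.
by rewrite starB starM starZ hh IH -shifts_comm.
Qed.

(** The last condition makes [f] the projection onto the full eigenspace.  For
selfadjoint [h] it makes [f] commute with all elements that commute with [h]. *)
Definition eigenprojection h l f :=
  [/\ projection f, f != 0, h ** f = l *: f &
      forall u, h ** u = l *: u -> f ** u = u].

Definition enough_eigenprojections :=
  forall h, selfadjoint h -> h != 0 ->
    exists l f, [/\ l \is Num.real, l != 0 & eigenprojection h l f].

(** The eigenvector [v] of [h], found by removing factors from an annihilating
product of shifts, is itself a polynomial in [h].  Hence [w = v^* v] acts on
the whole eigenspace of [h] as a scalar [c], and [c^-1 w] is the projection. *)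
Lemma proper_eigenprojections :
  algebraic A -> proper_involution A -> enough_eigenprojections.
Proof.
move=> algA prA h hh h0.
have [s v0 [l hv]] : exists2 s, shifts h s h != 0 &
    exists l, h ** shifts h s h = l *: shifts h s h.
  have [s] := algebraic_shifts (algA h).
  elim: s => [|l s IH] /=; first by move/eqP; rewrite (negPf h0).
  have [/IH // | v0] := eqVneq (shifts h s h) 0.
  by move/eqP; rewrite subr_eq0 => /eqP hv; exists s => //; exists l.
set v := shifts h s h in v0 hv *; set w := star v ** v.
have w0 : w != 0 by apply: contra_neq v0; exact: prA.
have ww : selfadjoint w := selfadjoint_starM v.
have vh : star v ** h = l^* *: star v by rewrite -[in LHS]hh -starM hv starZ.
(* [v^* h v] is both [l w] and the conjugate of [l] times [w]. *)
have lR : l \is Num.real.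
  apply/CrealP/(scale_inj w0).
  by rewrite -[RHS]numulZr -hv mulgA vh numulZl.
rewrite (conj_Creal lR) in vh.
have hw : h ** w = l *: w.
  by rewrite mulgA [star v]star_shifts // shifts_comm // -star_shifts // vh
    numulZl.
(* The value at [l] of the polynomial [X * \prod_m (X - m)]. *)
pose k s := \prod_(m <- s) (l - m) * l.
have act s' u : h ** u = l *: u -> shifts h s' h ** u = k s' *: u.
  move=> hu; rewrite -shifts_numul hu (shifts_eigen _ (l := l)) ?scalerA //.
  by rewrite numulZr hu scalerA.
pose c := k s * k (map Num.conj s).
have wu u : h ** u = l *: u -> w ** u = c *: u.
  move=> hu; rewrite -mulgA act // numulZr star_shifts // act //.
  by rewrite scalerA.
have c0 : c != 0.
  apply: contra_neq w0 => c0; apply: prA.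
  by rewrite ww wu // c0 scale0r.
have cR : c \is Num.real.
  by apply/CrealP/(scale_inj w0); rewrite -wu // -[in RHS]ww -starM wu // starZ
    ww.
have l0 : l != 0.
  by apply: contra_neq c0 => l0; rewrite /c /k l0 mulr0 mul0r.
exists l, (c^-1 *: w); split=> //; split.
- split; first by rewrite starZ_real ?rpredV // ww.
  by rewrite numulZl numulZr wu // [c^-1 *: (c *: _)]scalerA mulVf ?scale1r.
- by rewrite scaler_eq0 invr_eq0 negb_or c0.
- by rewrite numulZr hw !scalerA mulrC.
- by move=> u hu; rewrite numulZl wu // scalerA mulVf ?scale1r.
Qed.

(** * The spectral theorem *)

Definition comb n (e : 'I_n -> A) (phi : 'I_n -> C) : A :=
  \sum_(j < n) phi j *: e j.

Definition orthogonal_projections n (e : 'I_n -> A) :=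
  (forall j, projection (e j)) /\ (forall j k, j != k -> e j ** e k = 0).

Section Combinations.
Variables (n : nat) (e : 'I_n -> A).
Hypothesis orth : orthogonal_projections e.
Implicit Types (phi psi : 'I_n -> C).

Lemma mul_comb_proj phi j : comb e phi ** e j = phi j *: e j.
Proof.
case: orth => pr or; rewrite numul_suml (bigD1 j) //= big1 => [|k kj].
  by rewrite numulZl (pr j).2 addr0.
by rewrite numulZl or // scaler0.
Qed.

Lemma mul_proj_comb phi j : e j ** comb e phi = phi j *: e j.
Proof.
case: orth => pr or; rewrite numul_sumr (bigD1 j) //= big1 => [|k kj].
  by rewrite numulZr (pr j).2 addr0.
by rewrite numulZr or ?scaler0 // eq_sym.
Qed.

Lemma mul_comb phi psi :
  comb e phi ** comb e psi = comb e (fun j => phi j * psi j).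
Proof.
rewrite [X in _ ** X]/comb numul_sumr; apply: eq_bigr => j _.
by rewrite numulZr mul_comb_proj scalerA mulrC.
Qed.

Lemma star_comb phi : star (comb e phi) = comb e (fun j => (phi j)^*).
Proof.
by rewrite star_sum; apply: eq_bigr => j _; rewrite starZ (orth.1 j).1.
Qed.

Lemma projection_comb1 : projection (comb e (fun=> 1)).
Proof.
split; first by rewrite star_comb; apply: eq_bigr => j _; rewrite rmorph1.
by rewrite mul_comb; apply: eq_bigr => j _; rewrite mulr1.
Qed.

End Combinations.

Lemma combB n (e : 'I_n -> A) phi psi :
  comb e phi - comb e psi = comb e (fun j => phi j - psi j).
Proof. by rewrite -sumrB; apply: eq_bigr => j _; rewrite scalerBl. Qed.

Lemma combZ n (e : 'I_n -> A) l phi :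
  l *: comb e phi = comb e (fun j => l * phi j).
Proof. by rewrite scaler_sumr; apply: eq_bigr => j _; rewrite scalerA. Qed.

Lemma eq_comb n (e : 'I_n -> A) phi psi : phi =1 psi -> comb e phi = comb e psi.
Proof. by move=> ef; apply: eq_bigr => j _; rewrite ef. Qed.

Definition spectral_decomposition b n (lam : 'I_n -> C) (e : 'I_n -> A) :=
  [/\ injective lam /\ (forall j, lam j \is Num.real /\ lam j != 0),
      orthogonal_projections e, forall j, e j != 0 & b = comb e lam].

Definition spectral_theorem := forall b, selfadjoint b ->
  exists n (lam : 'I_n -> C) (e : 'I_n -> A), spectral_decomposition b lam e.

(** In a decomposition of [h] each [e_j] projects onto the full eigenspace of
[lam_j], because the [lam_j] are distinct and non-zero. *)
Lemma spectral_theorem_eigen : spectral_theorem -> enough_eigenprojections.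
Proof.
move=> spec h hh; have [n [lam [e [[lam_inj lamR] orth e0 ->]]]] := spec h hh.
case: n lam e => [|n] lam e in lam_inj lamR orth e0 *.
  by rewrite /comb big_ord0 eqxx.
move=> _; exists (lam ord0), (e ord0); split; try by have [] := lamR ord0.
split=> //; [exact: orth.1 | exact: mul_comb_proj |].
move=> u hu; have el j : lam j *: (e j ** u) = lam ord0 *: (e j ** u).
  by rewrite -numulZl -(mul_proj_comb orth) -mulgA hu numulZr.
have eu j : j != ord0 -> e j ** u = 0.
  move=> j0; apply/eqP; apply: contraTT j0 => eu; rewrite negbK.
  by apply/eqP/lam_inj/(scale_inj eu)/el.
apply: (scalerI (lamR ord0).2); rewrite -[RHS]hu numul_suml big_ord_recl big1.
  by rewrite addr0 numulZl.
by move=> i _; rewrite numulZl eu // scaler0.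
Qed.

(** Take an eigenprojection [f] of [h] for [l] and put [h' = h - h f].  Since
[f] covers the whole [l]-eigenspace, [l] is no longer an eigenvalue of [h'], so
[h'] is annihilated by the product of shifts from which [l] is removed once.
For the same reason [l] differs from all eigenvalues of [h']. *)
Lemma eigen_spectral_theorem :
  algebraic A -> enough_eigenprojections -> spectral_theorem.
Proof.
move=> algA eig h hh; have [s] := algebraic_shifts (algA h).
have [N] := ubnP (size s); elim: N => // N IH in s h hh *.
rewrite ltnS => sN hs.
have [-> | h0] := eqVneq h 0.
  exists 0, (fun=> 0), (fun=> 0); split=> //; try by case.
  - by split; case.
  - by split; case.
  - by rewrite /comb big_ord0.
have [l [f [lR l0 [[ff f2] f0 hf fmax]]]] := eig h hh h0.
have fh : f ** h = l *: f by rewrite -hh -[in LHS]ff -starM hf starZ_real ?ff.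
have ls : l \in s.
  have : shifts h s h ** f = 0 by rewrite hs numul0l.
  rewrite -shifts_numul hf (shifts_eigen _ (l := l)) ?numulZr ?hf //.
  move/eqP; rewrite !scaler_eq0 (negPf f0) (negPf l0) !orbF.
  by rewrite prodf_seq_eq0 => /hasP[m ms /=]; rewrite subr_eq0 => /eqP ->.
pose h' := h - h ** f.
have fh' : f ** h' = 0.
  by rewrite /h' hf numulBr numulZr f2 fh subrr.
have h'u u : f ** u = 0 -> h' ** u = h ** u.
  by move=> fu; rewrite numulBl -mulgA fu numul0r subr0.
have fshifts t u : f ** u = 0 -> f ** shifts h t u = 0.
  move=> fu; elim: t => //= m t IHt.
  by rewrite numulBr mulgA fh numulZl numulZr IHt !scaler0 subr0.
have shiftsE t u : f ** u = 0 -> shifts h' t u = shifts h t u.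
  by move=> fu; elim: t => //= m t ->; rewrite h'u ?fshifts.
have h's : shifts h' (rem l s) h' = 0.
  rewrite shiftsE //; set v := shifts _ _ _.
  have fv : f ** v = 0 by rewrite fshifts.
  rewrite -fv -{1}(fmax v) //; apply/eqP; rewrite -subr_eq0; apply/eqP.
  rewrite -shifts_cons -shifts_rem // shiftsB shifts_numul hs numul0l.
  by rewrite subr0.
have h'h' : selfadjoint h'.
  by rewrite /selfadjoint starB starM hh ff /h' hf fh.
have rN : (size (rem l s) < N)%N.
  by rewrite size_rem // prednK //; case: (s) ls.
have [n [lam [e [[lam_inj lamR] orth e0 h'E]]]] := IH _ _ h'h' rN h's.
have fe j : f ** e j = 0.
  apply: (scalerI (lamR j).2); rewrite scaler0 -numulZr.
  by rewrite -(mul_comb_proj orth) -h'E mulgA fh' numul0l.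
have ef j : e j ** f = 0.
  by rewrite -(orth.1 j).1 -[in LHS]ff -starM fe star0.
have laml j : lam j != l.
  apply: contraNneq (e0 j) => lamj; rewrite -(fmax (e j)) ?fe //.
  by rewrite -h'u // h'E mul_comb_proj // lamj.
pose ext T (x : T) (F : 'I_n -> T) (i : 'I_n.+1) :=
  if unlift ord0 i is Some j then F j else x.
have ext0 T (x : T) F : ext T x F ord0 = x by rewrite /ext unlift_none.
have extl T (x : T) F j : ext T x F (lift ord0 j) = F j by rewrite /ext liftK.
exists n.+1, (ext _ l lam), (ext _ f e); split.
- split=> [i i'|i]; case: (unliftP ord0 i) => [j|] ->; rewrite ?ext0 ?extl //.
  + case: (unliftP ord0 i') => [j'|] ->; rewrite ?ext0 ?extl.
      by move/lam_inj ->.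
    by move=> lj; move: (laml j); rewrite lj eqxx.
  + case: (unliftP ord0 i') => [j'|] ->; rewrite ?ext0 ?extl // => lj.
    by move: (laml j'); rewrite -lj eqxx.
- split=> [i|i i'].
    by case: (unliftP ord0 i) => [j|] ->; rewrite ?ext0 ?extl //; exact: orth.1.
  case: (unliftP ord0 i) => [j|] ->; case: (unliftP ord0 i') => [j'|] ->;
    rewrite ?ext0 ?extl ?eqxx // => jj'.
  by apply: orth.2; apply: contraNneq jj' => ->.
- by move=> i; case: (unliftP ord0 i) => [j|] ->; rewrite ?ext0 ?extl.
- rewrite /comb big_ord_recl !ext0.
  under eq_bigr do rewrite !extl.
  by rewrite -/(comb e lam) -h'E /h' hf addrC subrK.
Qed.

(** * Normal elements and properness *)

Lemma eigen_square_eq0 h : enough_eigenprojections -> selfadjoint h ->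
  h ** h = 0 -> h = 0.
Proof.
move=> eig hh h2; apply: contra_eq h2 => h0.
have [l [f [_ l0 [_ f0 hf _]]]] := eig h hh h0.
apply/eqP => h2; have := congr1 (fun x => x ** f) h2; rewrite /= -mulgA hf.
move/eqP; rewrite numulZr hf scalerA numul0l scaler_eq0 (negPf f0) orbF.
by rewrite mulf_eq0 (negPf l0).
Qed.

(** The eigenprojection [f] of [h] commutes with [g], so one may pass to the
selfadjoint [g f] and take an eigenvector of it; if [g f = 0], then [f] itself
is a joint eigenvector. *)
Lemma joint_eigenvector h g : enough_eigenprojections ->
    selfadjoint h -> selfadjoint g -> h ** g = g ** h -> h != 0 ->
  exists y l m, [/\ y != 0, l \is Num.real /\ l != 0, m \is Num.real,
    h ** y = l *: y & g ** y = m *: y].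
Proof.
move=> eig hh gg hg h0; have [l [f [lR l0 [[ff f2] f0 hf fmax]]]] := eig h hh
  h0.
have fgf : f ** (g ** f) = g ** f by apply: fmax;
  rewrite mulgA hg -mulgA hf numulZr.
have gf : g ** f = f ** g.
  by rewrite -[RHS]starK starM ff gg -fgf !starM ff gg -mulgA.
have [gf0|gf0] := eqVneq (g ** f) 0.
  by exists f, l, 0; split; rewrite // gf0 scale0r.
have gfgf : selfadjoint (g ** f) by rewrite /selfadjoint starM ff gg gf.
have [m [y [mR m0 [_ y0 gfy _]]]] := eig _ gfgf gf0.
have fy : f ** y = y.
  by apply: (scalerI m0); rewrite -numulZr -gfy mulgA fgf.
exists y, l, m; split=> //; rewrite -{1}fy mulgA ?hf ?gfy //.
by rewrite numulZl fy.
Qed.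

(** With [h = a + a^*] and [g = i (a - a^* )], which commute as [a] is normal,
[4 a^* a = h^2 + g^2] acts on a joint eigenvector by a sum of squares of real
numbers that do not both vanish. *)
Lemma normal_eigenvector a : enough_eigenprojections ->
    a ** star a = star a ** a -> a != 0 ->
  exists y l, [/\ y != 0, 0 < l & star a ** a ** y = l *: y].
Proof.
move=> eig na a0; set u := star a ** a in na *.
pose h := a + star a; pose g := 'i *: (a - star a).
have hh : selfadjoint h by rewrite /selfadjoint starD starK addrC.
have gg : selfadjoint g.
  by rewrite /selfadjoint starZ starB starK conjCi scaleNr -scalerN opprB.
have hg : h ** g = g ** h.
  by rewrite numulZl numulZr; congr (_ *: _);
    rewrite !numulE na -/u subrKA addrA addrK.
have sq : h ** h + g ** g = 4 *: u.
  have hhE : h ** h = (a ** a + star a ** star a) + u *+ 2.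
    by rewrite !numulE na -/u (AC (2*2) ((1*4)*(2*3))) mulr2n.
  have ggE : g ** g = u *+ 2 - (a ** a + star a ** star a).
    rewrite numulZl numulZr scalerA -expr2 sqrCi scaleN1r !numulE na -/u opprK.
    by rewrite (AC (2*2) ((1*4)*(2*3)))/= -mulr2n mulNrn opprB.
  by rewrite ggE addrC hhE addrA subrK -mulrnDr scaler_nat.
have [y [l [m [y0 [lR l0] mR ly]]]] : exists y l m, [/\ y != 0,
    l \is Num.real /\ l != 0, m \is Num.real &
    (h ** h + g ** g) ** y = (l ^+ 2 + m ^+ 2) *: y].
  have sqr z l y : z ** y = l *: y -> z ** z ** y = l ^+ 2 *: y.
    by move=> zy; rewrite -mulgA zy numulZr zy scalerA.
  have [h0|h0] := eqVneq h 0.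
    have g0 : g != 0.
      have aE : star a = - a by apply/eqP; rewrite -addr_eq0 addrC; apply/eqP.
      rewrite /g aE opprK -mulr2n scaler_eq0 (negPf (neq0Ci C)) /= -scaler_nat.
      by rewrite scaler_eq0 pnatr_eq0.
    have [y [l [m [y0 lR0 mR ly my]]]] :=
      joint_eigenvector eig gg hh (esym hg) g0.
    exists y, l, m; split=> //.
    by rewrite numulDl (sqr _ _ _ ly) (sqr _ _ _ my) addrC scalerDl.
  have [y [l [m [y0 lR0 mR ly my]]]] := joint_eigenvector eig hh gg hg h0.
  exists y, l, m; split=> //.
  by rewrite numulDl (sqr _ _ _ ly) (sqr _ _ _ my) scalerDl.
exists y, ((l ^+ 2 + m ^+ 2) / 4); split=> //.
  rewrite divr_gt0 ?ltr0n // ltr_pwDl ?real_exprn_even_gt0 //.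
  by rewrite real_exprn_even_ge0.
apply: (scalerI (a := 4)); first by rewrite pnatr_eq0.
by rewrite -numulZl -sq ly scalerA mulrCA mulfV ?pnatr_eq0 // mulr1.
Qed.

(** If [a^* a = 0], then [(a a^* )^2 = 0] and so [a a^* = 0]: the element [a] is
normal, and the previous lemma applies. *)
Lemma eigen_proper : enough_eigenprojections -> proper_involution A.
Proof.
move=> eig a aa0; apply/eqP/negPn/negP => a0.
have aa' : a ** star a = 0.
  apply: (eigen_square_eq0 eig); first by rewrite /selfadjoint starM starK.
  by rewrite -mulgA [star a ** _]mulgA aa0 numul0l numul0r.
have [y [l [y0 l0]]] := normal_eigenvector eig (etrans aa' (esym aa0)) a0.
move/esym/eqP; rewrite aa0 numul0l scaler_eq0 (negPf y0) orbF.
by rewrite (gt_eqF l0).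
Qed.
(** * Positivity of squares *)

(** Dedekind finiteness of the corner [p A p]: a right invertible [c] is not a
left zero divisor.  Since [c d = p], a factor [c] can be cancelled from an
annihilating product of shifts; once the root [0] is gone, the product acts on
the kernel of [c] as a non-zero scalar. *)
Lemma corner_left_regular p c d g : algebraic A ->
    p ** c = c -> c ** p = c -> c ** d = p ->
  p ** g = g -> c ** g = 0 -> g = 0.
Proof.
move=> algA pc cp cd pg cg; have pp : p ** p = p by rewrite -{2}cd mulgA pc.
have [s] := algebraic_shifts (algA c).
move/(congr1 (fun x => x ** d)); rewrite -shifts_numul cd numul0l.
have [N] := ubnP (size s); elim: N => // N IH in s *; rewrite ltnS => sN sp.
have [s0|s0] := boolP (0 \in s).
  apply: (IH (rem 0 s)).
    by rewrite size_rem // prednK //; case: (s) s0.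
  move: sp; rewrite (shifts_rem _ _ s0) shifts_cons scale0r subr0.
  rewrite shifts_comm ?pc ?cp // => /(congr1 (fun x => x ** d)).
  by rewrite numul0l -mulgA cd -shifts_numul pp.
have : shifts c s p ** g = 0 by rewrite sp numul0l.
rewrite -shifts_numul pg (shifts_eigen _ (l := 0)) ?scale0r //.
move/eqP; rewrite scaler_eq0 prodf_seq_eq0 => /orP[/hasP[m ms /=]|/eqP //].
by rewrite sub0r oppr_eq0 => /eqP m0; move: s0; rewrite -m0 ms.
Qed.

(** If [p f p = l p] with [l < 0] and [p <> 0], then [p] and [f p] span an
indefinite plane for the form [x^* y], which contains an isotropic vector. *)
Lemma two_projections p f l : proper_involution A -> projection p ->
    projection f -> l \is Num.real -> l < 0 -> p ** f ** p = l *: p -> p = 0.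
Proof.
move=> prA [pp p2] [ff f2] lR l0 pfp.
(* [t] is a root of [1 + 2 l t + l t^2], the coefficient of [p] in
   [a^* a] for [a = p + t f p]. *)
pose r := sqrtC (1 - l^-1); pose t := r - 1.
have r0 : 0 < 1 - l^-1 by rewrite subr_gt0 (lt_trans _ ltr01) // invr_lt0.
have tR : t \is Num.real by rewrite rpredB ?rpred1 // ger0_real // sqrtC_ge0
  ltW.
have a0 : p + t *: (f ** p) = 0.
  apply: prA; rewrite starD starZ_real // starM pp ff !numulE.
  have -> : p ** f ** (f ** p) = l *: p by rewrite mulgA -(mulgA p f f) f2.
  rewrite (mulgA p f p) pfp p2 !scalerA -[X in X + (t * l) *: _]scale1r
    -!scalerDl.
  have -> : 1 + t * l + (t * l + t * t * l) = 0; last exact: scale0r.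
  have -> : 1 + t * l + (t * l + t * t * l) = l * (r ^+ 2) + (1 - l).
    by rewrite /t; ring.
  by rewrite sqrtCK mulrBr mulr1 mulfV ?lt_eqF // addrC subrKA subrr.
have fp0 : f ** p = 0.
  have := congr1 (fun x => f ** x) a0.
  rewrite /= numulDr numulZr mulgA f2 numul0r -[X in X + _]scale1r -scalerDl.
  rewrite addrC subrK => /eqP; rewrite scaler_eq0 sqrtC_eq0 (gt_eqF r0) /=.
  by move/eqP.
by move: a0; rewrite fp0 scaler0 addr0.
Qed.

Lemma idempotent_eigen_ge0 p y l : p ** p = p -> y != 0 -> p ** y = l *: y ->
  0 <= l.
Proof.
move=> p2 y0 py; have : l ^+ 2 *: y = l *: y.
  by rewrite -py -p2 -mulgA py numulZr py scalerA expr2.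
move/(scale_inj y0)/eqP; rewrite -subr_eq0 -{2}[l]mulr1 -mulrBr mulf_eq0.
by rewrite subr_eq0 => /orP[] /eqP ->.
Qed.

(** Set [q = - b b^*], a projection with [q b = b], and [x = p q p].  The kernel
projection [p0] of [x] in [p A p] vanishes, since [p0 + b p0] is isotropic; the
eigenvalues of [x] are positive by the lemma on two projections.  So [x] has an
inverse square root [y] in [p A p], and [c = y b] satisfies [c c^* = - y x y =
- p].  Now [c^* c = - p] by Dedekind finiteness, so [c] is normal. *)
Lemma no_negative_square p b : algebraic A -> enough_eigenprojections ->
  projection p -> b ** p = b -> star b ** b = - p -> p = 0.
Proof.
move=> algA eig [pp p2] bp bb; have prA := eigen_proper eig.
pose q := - (b ** star b).
have qq : star q = q by rewrite starN starM starK.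
have qb : q ** b = b by rewrite numulNl -mulgA bb numulNr bp opprK.
have q2 : q ** q = q by rewrite {2 3}/q numulNr mulgA qb.
pose x := p ** q ** p.
have xx : selfadjoint x by rewrite /selfadjoint !starM pp qq mulgA.
have px : p ** x = x by rewrite !mulgA p2.
have xp : x ** p = x by rewrite -[LHS]mulgA p2.
have [n [lam [e [[_ lamR] orth e0 xE]]]] := eigen_spectral_theorem algA eig xx.
have pe j : p ** e j = e j.
  apply: (scalerI (lamR j).2).
  by rewrite -numulZr -(mul_comb_proj orth) -xE mulgA px.
have ep j : e j ** p = e j.
  by rewrite -[in LHS](orth.1 j).1 -[in LHS]pp -starM pe (orth.1 j).1.
have pcomb phi : p ** comb e phi = comb e phi.
  by rewrite numul_sumr; apply: eq_bigr => j _; rewrite numulZr pe.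
have combp phi : comb e phi ** p = comb e phi.
  by rewrite numul_suml; apply: eq_bigr => j _; rewrite numulZl ep.
(* [x] is invertible in [p A p]: its support [E] is all of [p]. *)
pose E := comb e (fun=> 1); have [EE E2] := projection_comb1 orth.
have pE : p = E.
  apply/eqP; rewrite -subr_eq0; set p0 := p - E.
  have pp0 : star p0 = p0 by rewrite starB pp EE.
  have pp0' : p ** p0 = p0 by rewrite numulBr p2 pcomb.
  have p0p : p0 ** p = p0 by rewrite numulBl p2 combp.
  have p02 : p0 ** p0 = p0.
    by rewrite numulBr p0p numulBl pcomb E2 subrr subr0.
  have xE1 : x ** E = x.
    by rewrite {1}xE mul_comb // xE; apply: eq_comb => j; rewrite mulr1.
  have xp0 : x ** p0 = 0 by rewrite numulBr xp xE1 subrr.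
  clearbody p0.
  have qp0 : q ** p0 = 0.
    apply: prA; rewrite starM qq pp0 mulgA -(mulgA p0 q q) q2.
    by rewrite -{1}p0p -{2}pp0' -!mulgA (mulgA p q) (mulgA _ p) -/x xp0 numul0r.
  have p0q : p0 ** q = 0 by rewrite -qq -pp0 -starM qp0 star0.
  have p0b : p0 ** b = 0 by rewrite -qb mulgA p0q numul0l.
  have bp0 : star b ** p0 = 0 by rewrite -[p0]pp0 -starM p0b star0.
  have : p0 + b ** p0 = 0.
    apply: prA; rewrite starD starM pp0 !numulE.
    rewrite -(mulgA p0 (star b)) bp0 numul0r add0r (mulgA p0 b) p0b numul0l.
    by rewrite addr0 mulgA -(mulgA p0) bb numulNr p0p numulNl p02 subrr.
  move/(congr1 (fun x => p0 ** x)); rewrite /= numulDr p02 mulgA p0b numul0l.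
  by rewrite addr0 numul0r => ->.
(* [e_j q e_j = lam_j e_j], so that a negative eigenvalue is impossible. *)
have lam_gt0 j : 0 < lam j.
  have [lR l0] := lamR j; rewrite real_ltNge ?real0 //.
  rewrite le_eqVlt (negPf l0) /=; apply: contraNN (e0 j) => lj0; apply/eqP.
  apply: (two_projections prA (orth.1 j) (conj qq q2) lR lj0).
  rewrite -{1}ep -{2}pe -!mulgA (mulgA p q) (mulgA _ p) -/x.
  by rewrite xE mul_comb_proj // numulZr (orth.1 j).2.
pose r j := (sqrtC (lam j))^-1; pose y := comb e r.
have rR j : r j \is Num.real by rewrite rpredV ger0_real // sqrtC_ge0 ltW.
have yy : star y = y.
  by rewrite star_comb //; apply: eq_comb => j; rewrite conj_Creal.
have yxy : y ** x ** y = p.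
  rewrite xE !mul_comb // pE; apply: eq_comb => j.
  rewrite mulrAC -expr2 exprVn sqrtCK mulVf //; exact: (lamR j).2.
have py : p ** y = y by exact: pcomb.
have yp : y ** p = y by exact: combp.
pose c := y ** b.
have pc : p ** c = c by rewrite mulgA py.
have cp : c ** p = c by rewrite -[LHS]mulgA bp.
have cc : c ** star c = - p.
  rewrite starM yy mulgA -(mulgA y b) -[b ** star b]opprK -/q numulNr numulNl.
  by congr (- _); rewrite -yxy /x !mulgA yp -(mulgA _ p y) py.
have psc : p ** star c = star c by rewrite -[in LHS]pp -starM cp.
(* [c] kills [p + c^* c]. *)
have cc' : star c ** c = - p.
  apply/eqP; rewrite -addr_eq0 addrC; apply/eqP.
  apply: (corner_left_regular algA pc cp (d := - star c)).
  - by rewrite numulNr cc opprK.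
  - by rewrite numulDr p2 mulgA psc.
  - by rewrite numulDr cp mulgA cc numulNl pc subrr.
have [c0|c0] := eqVneq c 0.
  by move: cc; rewrite c0 numul0l => /eqP; rewrite eq_sym oppr_eq0 => /eqP.
have [z [l [z0 l0]]] := normal_eigenvector eig (etrans cc (esym cc')) c0.
rewrite cc' numulNl => /eqP; rewrite eqr_oppLR -scaleNr => /eqP.
by move/(idempotent_eigen_ge0 p2 z0); rewrite oppr_ge0 (lt_geF l0).
Qed.

(** If [l < 0], the element [(- l)^(-1/2) a f] contradicts the previous
lemma. *)
Lemma eigen_positive_square a f l : algebraic A -> enough_eigenprojections ->
    projection f -> f != 0 -> l \is Num.real -> star a ** a ** f = l *: f ->
  0 <= l.
Proof.
move=> algA eig [ff f2] f0 lR aaf; rewrite real_leNgt ?real0 //.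
apply: contraNN f0 => l0; apply/eqP.
have l0' : 0 < - l by rewrite oppr_gt0.
pose r := (sqrtC (- l))^-1.
have rR : r \is Num.real by rewrite rpredV ger0_real // sqrtC_ge0 ltW.
apply: (no_negative_square algA eig (b := r *: (a ** f))) => //.
  by rewrite numulZl -mulgA f2.
rewrite starZ_real // starM ff numulZl numulZr scalerA -mulgA (mulgA _ a) aaf.
rewrite numulZr f2 scalerA -expr2 exprVn sqrtCK invrN mulNr mulVf ?lt_eqF //.
by rewrite scaleN1r.
Qed.

(** * The positive cone *)

Definition psd h := exists c, h = star c ** c.

Section Positivity.
Hypothesis algA : algebraic A.
Hypothesis eig : enough_eigenprojections.

Lemma psd_selfadjoint h : psd h -> selfadjoint h.
Proof. by move=> [c ->]; exact: selfadjoint_starM. Qed.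

Lemma psd_eigen h f l : psd h -> projection f -> f != 0 ->
  l \is Num.real -> h ** f = l *: f -> 0 <= l.
Proof. by move=> [c ->]; exact: eigen_positive_square. Qed.

(** Square roots are taken on the eigenvalues. *)
Lemma eigen_psd h : selfadjoint h ->
  (forall f l, projection f -> f != 0 -> l \is Num.real ->
     h ** f = l *: f -> 0 <= l) -> psd h.
Proof.
move=> hh hpos.
have [n [lam [e [[_ lamR] orth e0 hE]]]] := eigen_spectral_theorem algA eig hh.
have lam_ge0 j : 0 <= lam j.
  apply: (hpos (e j)) => //; [exact: orth.1 | exact: (lamR j).1|].
  by rewrite hE mul_comb_proj.
exists (comb e (fun j => sqrtC (lam j))).
rewrite star_comb // mul_comb // hE; apply: eq_comb => j.
by rewrite conj_Creal ?ger0_real ?sqrtC_ge0 // -expr2 sqrtCK.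
Qed.

Lemma psd0 : psd 0.
Proof. by exists 0; rewrite numul0r. Qed.

(** If [(a^* a + b^* b) f = l f], then [u = (a f)^* (a f)] and
[v = (b f)^* (b f)] add up to [l f].  An eigenprojection of [u], which lies
below [f], is one of [v] too, and the two eigenvalues are non-negative with sum
[l]. *)
Lemma psdD h g : psd h -> psd g -> psd (h + g).
Proof.
move=> psh psg; apply: eigen_psd.
  by rewrite /selfadjoint starD (psd_selfadjoint psh) (psd_selfadjoint psg).
move: psh psg => [a ->] [b ->] f l prf f0 lR hf; have [ff f2] := prf.
pose u := star (a ** f) ** (a ** f); pose v := star (b ** f) ** (b ** f).
have uv : u + v = l *: f.
  rewrite /u /v !starM ff -!(mulgA f) -numulDr (mulgA (star a)) (mulgA (star
    b)).
  by rewrite -numulDl hf numulZr f2.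
have [u0|u0] := eqVneq u 0.
  apply: (psd_eigen (h := v) _ prf) => //; first by exists (b ** f).
  by move: uv; rewrite u0 add0r => ->; rewrite numulZl f2.
have [m [e [mR m0 [pre e0 ue _]]]] := eig (selfadjoint_starM _) u0.
have fu : f ** u = u by rewrite /u starM ff !mulgA f2.
have fe : f ** e = e.
  by apply: (scalerI m0); rewrite -numulZr -ue mulgA fu.
have ve : v ** e = (l - m) *: e.
  by rewrite -[v](addKr u) uv numulDl numulNl ue numulZl fe addrC scalerBl.
have m_ge0 : 0 <= m by apply: (psd_eigen _ pre e0 mR ue); exists (a ** f).
rewrite (le_trans m_ge0) // -subr_ge0.
by apply: (psd_eigen _ pre e0 _ ve); [exists (b ** f) | rewrite rpredB].
Qed.

Lemma psdZ l h : 0 <= l -> psd h -> psd (l *: h).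
Proof.
move=> l0 [c ->]; exists (sqrtC l *: c).
rewrite starZ_real ?ger0_real ?sqrtC_ge0 // numulZl numulZr scalerA.
by rewrite -expr2 sqrtCK.
Qed.

Lemma psd_sum n (F : 'I_n -> A) :
  (forall j, psd (F j)) -> psd (\sum_(j < n) F j).
Proof. by move=> psF; elim/big_rec: _ => [|j x _];
  [exact: psd0 | exact: psdD]. Qed.

Lemma psd_anti h : psd h -> psd (- h) -> h = 0.
Proof.
move=> psh psNh; apply/eqP/negPn/negP => h0.
have [l [f [lR l0 [prf f0 hf _]]]] := eig (psd_selfadjoint psh) h0.
have l_ge0 := psd_eigen psh prf f0 lR hf.
have : 0 <= - l.
  by apply: (psd_eigen psNh prf f0); rewrite ?rpredN // numulNl hf scaleNr.
by rewrite oppr_ge0 => l_le0; move: l0; rewrite eq_le l_le0 l_ge0.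
Qed.

Lemma psd_projection f x : projection f ->
  psd (star x ** x - star x ** f ** x).
Proof.
move=> [ff f2]; exists (x - f ** x); rewrite starB starM ff !numulE !mulgA.
by rewrite -(mulgA _ f f) f2 subrr addr0.
Qed.

(** [t] bounds the left multiplication by [a] on [A], seen as a Hilbert module
over itself with inner product [x^* y]. *)
Definition bounded_by a t := forall x,
  psd (t ^+ 2 *: (star x ** x) - star (a ** x) ** (a ** x)).

Lemma bounded_byW a l m : 0 <= l -> l <= m -> bounded_by a l -> bounded_by a m.
Proof.
move=> l0 lm al x; have -> : m ^+ 2 = (m ^+ 2 - l ^+ 2) + l ^+ 2 by ring.
rewrite scalerDl -addrA; apply: psdD; last exact: al.
by apply: psdZ; [rewrite subr_ge0 lerXn2r ?nnegrE // (le_trans l0) | exists x].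
Qed.

Lemma bounded_by0 l : 0 <= l -> bounded_by 0 l.
Proof.
move=> l0 x; rewrite numul0l numul0r subr0.
by apply: psdZ; [exact: exprn_ge0 | exists x].
Qed.

Lemma bounded_byZ a l m : bounded_by a m -> bounded_by (l *: a) (`|l| * m).
Proof.
move=> am x; rewrite numulZl starZ numulZl numulZr scalerA [l^* * l]mulrC
  -normCK.
by rewrite exprMn -scalerA -scalerBr; apply: psdZ; rewrite ?exprn_ge0.
Qed.

Lemma bounded_byM a b l m : 0 <= l ->
  bounded_by a l -> bounded_by b m -> bounded_by (a ** b) (l * m).
Proof.
move=> l0 al bm x; rewrite -mulgA.
rewrite -(subrK (l ^+ 2 *: (star (b ** x) ** (b ** x))) (_ *: _)) -addrA.
apply: psdD; last exact: al.
rewrite exprMn -scalerA -scalerBr.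
by apply: psdZ; [exact: exprn_ge0 | exact: bm].
Qed.

(** From [(u + v)^* (u + v) <= (1 + m/l) u^* u + (1 + l/m) v^* v]; the
difference is [w^* w] for [w = r u - r^-1 v] with [r^2 = m / l]. *)
Lemma bounded_byD a b l m : 0 < l -> 0 < m ->
  bounded_by a l -> bounded_by b m -> bounded_by (a + b) (l + m).
Proof.
move=> l0 m0 al bm x; rewrite numulDl; set u := a ** x; set v := b ** x.
have l_neq0 : l != 0 by rewrite gt_eqF.
have m_neq0 : m != 0 by rewrite gt_eqF.
have ml0 : 0 < m / l by rewrite divr_gt0.
pose r := sqrtC (m / l); pose c := 1 + m / l; pose d := 1 + l / m.
have r_neq0 : r != 0 by rewrite sqrtC_eq0 gt_eqF.
have rR : r \is Num.real by rewrite ger0_real // sqrtC_ge0 ltW.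
pose w := r *: u - r^-1 *: v.
have sumE : star (u + v) ** (u + v) + star w ** w =
    c *: (star u ** u) + d *: (star v ** v).
  rewrite /w starB !starZ_real ?rpredV // starD !numulE !scalerA opprK.
  rewrite mulfV // mulVf // !scale1r -!expr2 exprVn sqrtCK invf_div.
  rewrite (AC ((2*2)*(2*2)) (((1*5)*(4*8))*((2*6)*(3*7)))) /=.
  by rewrite !subrr !addr0 !scalerDl !scale1r.
have -> : star (u + v) ** (u + v) =
    c *: (star u ** u) + d *: (star v ** v) - star w ** w.
  by rewrite -sumE addrK.
have -> : (l + m) ^+ 2 = c * l ^+ 2 + d * m ^+ 2.
  by rewrite /c /d; field; rewrite l_neq0 m_neq0.
rewrite opprB addrCA opprD scalerDl addrACA -(scalerA c) -(scalerA d)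
  -!scalerBr.
have c0 : 0 <= c by rewrite ltW // addr_gt0 ?ltr01.
have d0 : 0 <= d by rewrite ltW // addr_gt0 ?ltr01 ?divr_gt0.
apply: psdD; first by exists w.
by apply: psdD; apply: psdZ.
Qed.

(** [a^* a] is a combination of projections with non-negative coefficients, and
[x^* f x <= x^* x] for a projection [f]. *)
Lemma bounded_by_exists a : exists2 t, 0 <= t & bounded_by a t.
Proof.
have [n [lam [e [[_ lamR] orth e0 aE]]]] :=
  eigen_spectral_theorem algA eig (selfadjoint_starM a).
have lam_ge0 j : 0 <= lam j.
  apply: (psd_eigen (h := star a ** a) _ (orth.1 j)) => //; first by exists a.
    exact: (lamR j).1.
  by rewrite aE mul_comb_proj.
have sum_ge0 : 0 <= \sum_(j < n) lam j by apply: sumr_ge0.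
exists (sqrtC (\sum_(j < n) lam j)) => [|x]; first by rewrite sqrtC_ge0.
rewrite sqrtCK starM mulgA -(mulgA (star x)) aE numul_sumr numul_suml.
rewrite scaler_suml -sumrB; apply: psd_sum => j.
rewrite numulZr numulZl -scalerBr; apply: psdZ => //.
by apply: psd_projection; exact: orth.1.
Qed.

(** The inequality behind the C*-identity.  With [h = a^* a],
[0 <= (h - t)^2] gives [2 t x^* h x <= x^* h^2 x + t^2 x^* x <= 2 t^2 x^* x]. *)
Lemma bounded_by_starM a t : 0 < t -> bounded_by (star a ** a) t ->
  bounded_by a (sqrtC t).
Proof.
move=> t0 aat x; rewrite sqrtCK starM mulgA -(mulgA (star x)).
have tR : t \is Num.real by rewrite gtr0_real.
set h := star a ** a in aat *; have hh : star h = h := selfadjoint_starM a.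
have : psd ((t ^+ 2 *: (star x ** x) - star (h ** x) ** (h ** x)) +
            star (h ** x - t *: x) ** (h ** x - t *: x)).
  by apply: psdD; [exact: aat | exists (h ** x - t *: x)].
have -> : t ^+ 2 *: (star x ** x) - star (h ** x) ** (h ** x) +
            star (h ** x - t *: x) ** (h ** x - t *: x) =
  (t *+ 2) *: (t *: (star x ** x) - star x ** h ** x).
  rewrite starB starZ_real // starM hh !numulE !mulgA scalerA -expr2.
  rewrite opprK (AC (2*(2*2)) (((1*6)*(4*5))*(2*3))) /= addNr addr0.
  by rewrite -!mulr2n mulNrn -mulrnBl -scalerMnl scalerBr scalerA -expr2.
move/(psdZ (l := (t *+ 2)^-1)); rewrite invr_ge0 mulrn_wge0 ?(ltW t0) // => /(_
  isT).
by rewrite scalerA mulVf ?scale1r // mulrn_eq0 /= gt_eqF.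
Qed.

(** An eigenvalue [l > 0] of [a^* a] is a lower bound for the square of any
bound of [a]. *)
Lemma bounded_by_eq0 a : (forall t, 0 < t -> bounded_by a t) -> a = 0.
Proof.
move=> a_small; apply/eqP/negPn/negP => a0.
have aa0 : star a ** a != 0 by apply: contra_neq a0; exact: eigen_proper.
have [l [f [lR l0 [prf f0 af _]]]] := eig (selfadjoint_starM a) aa0.
have [ff f2] := prf.
have l_gt0 : 0 < l.
  by rewrite lt_neqAle eq_sym l0 (psd_eigen _ prf f0 lR af) //; exists a.
have l2 : 0 < l / 2 by rewrite divr_gt0 ?ltr0n.
have := a_small (sqrtC (l / 2)); rewrite sqrtC_gt0 => /(_ l2 f).
rewrite sqrtCK starM ff f2 mulgA -!(mulgA f) af numulZr f2 -scalerBl => psf.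
move/eqP: f0; apply; apply: (scalerI (a := l / 2)); first by rewrite gt_eqF.
rewrite scaler0; apply: psd_anti; first by apply: psdZ; [exact: ltW | exists f;
  rewrite ff f2].
by rewrite -scaleNr; have -> : - (l / 2) = l / 2 - l by field.
Qed.

End Positivity.

(** * Consequences of the spectral theorem, and converses *)

Lemma support_projection a n (lam : 'I_n -> C) (e : 'I_n -> A) :
  proper_involution A ->
  spectral_decomposition (star a ** a) lam e -> a ** comb e (fun=> 1%R) = a.
Proof.
move=> prA [_ orth _ aE]; set E := comb e _.
have [EE _] : projection E := projection_comb1 orth.
have Eaa : E ** (star a ** a) = star a ** a.
  by rewrite aE mul_comb //; apply: eq_comb => j; rewrite mul1r.
apply/eqP; rewrite eq_sym -subr_eq0; apply/eqP/prA.
rewrite starB starM EE numulBr mulgA numulBl -(mulgA E) Eaa subrr numul0l.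
by rewrite subrr.
Qed.

Lemma spectral_weakly_rickart : spectral_theorem -> weakly_rickart A.
Proof.
move=> spec a; have prA := eigen_proper (spectral_theorem_eigen spec).
have [n [lam [e dec]]] := spec _ (selfadjoint_starM a).
exists (comb e (fun=> 1)); have aE := support_projection prA dec.
have [[_ lamR] orth _ aaE] := dec; split=> // [|y ay0].
  exact: projection_comb1.
have ey j : e j ** y = 0.
  apply: (scalerI (lamR j).2); rewrite -numulZl -(mul_proj_comb orth) -aaE.
  by rewrite -!mulgA ay0 !numul0r scaler0.
by rewrite numul_suml big1 // => j _; rewrite numulZl ey scaler0.
Qed.

Lemma weakly_rickart_proper : weakly_rickart A -> proper_involution A.
Proof.
move=> ric a aa0; have [e [[ee _] ae emin]] := ric (star a).
by rewrite -[a]starK -ae starM starK ee emin.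
Qed.

Lemma spectral_regular : spectral_theorem -> von_neumann_regular A.
Proof.
move=> spec a; have prA := eigen_proper (spectral_theorem_eigen spec).
have [n [lam [e dec]]] := spec _ (selfadjoint_starM a).
have [[_ lamR] orth _ aaE] := dec.
exists (comb e (fun j => (lam j)^-1)%R ** star a).
rewrite mulgA -!mulgA aaE mul_comb // -[RHS](support_projection prA dec).
by congr (_ ** _); apply: eq_comb => j; rewrite mulVf //; exact: (lamR j).2.
Qed.

(** For [l] not real, [(l - a)^-1 - l^-1] is obtained by applying the function
[x / (l (l - x))] to the eigenvalues of [a]. *)
Lemma spectral_hermitian : spectral_theorem -> hermitian_algebra A.
Proof.
move=> spec a aa l; apply: contraPT => lnR.
have l0 : l != 0 by apply: contraNneq lnR => ->; exact: real0.
have [n [lam [e [[_ lamR] orth _ aE]]]] := spec a aa.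
apply: (quasi_invertible_notin_spectrum l0).
exists (comb e (fun j => lam j / (l * (l - lam j)))).
have ll j : l - lam j != 0.
  by rewrite subr_eq0; apply: contraNneq lnR => ->; exact: (lamR j).1.
rewrite aE !mul_comb // !combZ !combB.
by split; apply: eq_comb => j; field; rewrite l0 ll.
Qed.

(** [(1 + b^* )(1 - b) = 1 - s] with [s = b - b^*], as [b^* b = 0].  Since [i s]
is selfadjoint, [i] is not in its spectrum, which yields a left inverse [1 + x]
of [1 - s], and then [(1 + x)(1 + b^* )] is a left inverse of [1 - b]. *)
Lemma hermitian_quasi_regular b : hermitian_algebra A -> star b ** b = 0 ->
  exists y, y - y ** b = b.
Proof.
move=> herA bb; pose s := b - star b; pose h := 'i *: s.
have hh : selfadjoint h.
  by rewrite /selfadjoint starZ starB starK conjCi scaleNr -scalerN opprB.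
have iR : ~ ('i : C) \is Num.real.
  move=> /CrealP/eqP; rewrite conjCi eq_sym -addr_eq0 -mulr2n.
  by rewrite mulrn_eq0 (negPf (neq0Ci C)).
have [z hz] : exists z, 'i *: z - z ** h = 'i^-1 *: h.
  apply: notin_spectrum_quasi_invertible; first exact: neq0Ci.
  by move=> /(herA _ hh)/iR.
pose x := 'i *: z.
have xs : x - x ** s = s.
  move: hz; rewrite /h numulZr scalerA mulVf ?neq0Ci // scale1r.
  by rewrite /x numulZl.
exists (x + star b + x ** star b).
rewrite !numulDl bb -(mulgA x) bb numul0r !addr0.
rewrite -[RHS](subrK (star b)) -/s -xs /s numulBr opprB.
by rewrite (AC (3*1) ((1*(3*4))*2)).
Qed.

Lemma hermitian_quasi_regular_ideal a x : hermitian_algebra A ->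
  star a ** a = 0 -> exists y, y - y ** (x ** a) = x ** a.
Proof.
move=> herA aa; apply: quasi_regular_swap; apply: hermitian_quasi_regular => //.
by rewrite starM -mulgA (mulgA _ a) aa numul0l numul0r.
Qed.

Lemma hermitian_semisimple_proper :
  hermitian_algebra A -> semisimple A -> proper_involution A.
Proof.
move=> herA ssA a aa.
suff : jacobson_radical a by rewrite ssA.
apply: quasi_regular_radical => x.
exact: hermitian_quasi_regular_ideal.
Qed.

Lemma hermitian_regular_proper :
  hermitian_algebra A -> von_neumann_regular A -> proper_involution A.
Proof.
move=> herA vnA a aa; have [x axa] := vnA a.
have [y yE] := hermitian_quasi_regular_ideal x herA aa.
have xaxa : x ** a ** (x ** a) = x ** a by rewrite -mulgA [a ** _]mulgA axa.
have := congr1 (fun z => z ** (x ** a)) yE.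
rewrite /= numulBl -(mulgA y) xaxa subrr => xa0.
by rewrite -axa -mulgA -xa0 numul0r.
Qed.

(** A left ideal containing [a] contains [a^* a], hence also its
eigenprojections, and no non-zero projection lies in the radical. *)
Lemma spectral_semisimple : spectral_theorem -> semisimple A.
Proof.
move=> spec; have eig := spectral_theorem_eigen spec.
apply/seteqP; split=> [a rad_a|_ ->]; last first.
  by move=> I [[[]]].
apply/eqP/negPn/negP => a0.
have aa0 : star a ** a != 0 by apply: contra_neq a0; exact: eigen_proper.
have [l [f [lR l0 [[ff f2] f0 af _]]]] := eig _ (selfadjoint_starM a) aa0.
apply: (idempotent_notin_radical f2 f0).
have -> : f = (l^-1%R *: (f ** star a)) ** a.
  rewrite numulZl -mulgA; apply: (scalerI l0); rewrite scalerA mulfV // scale1r.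
  by rewrite -[RHS](starK) starM selfadjoint_starM ff af starZ_real ?ff.
by move=> I maxI; have [[_ Imul] _ _ _] := maxI; apply: Imul; exact: rad_a.
Qed.

End Star.

(** * The pre-C*-norm *)

Section OperatorNorm.
Variables (R : realType) (A : starAlgType R[i]).
Hypothesis algA : algebraic A.
Hypothesis eig : enough_eigenprojections A.
Implicit Types (a b : A) (s t : R).

Definition bounds a : set R := [set t | 0 < t /\ bounded_by a t%:C%C].

Definition operator_norm a : R := inf (bounds a).

Lemma bounds_nonempty a : bounds a !=set0.
Proof.
have [z z0 az] := bounded_by_exists algA eig a.
have zE : z = (complex.Re z)%:C%C by rewrite RRe_real // ger0_real.
exists (complex.Re z + 1); split.
  by rewrite ltr_wpDl // -lecR -zE.
apply: (bounded_byW algA eig z0) az.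
by rewrite [X in X <= _]zE lecR lerDl.
Qed.

Lemma operator_norm_ge0 a : 0 <= operator_norm a.
Proof. by apply: lb_le_inf; [exact: bounds_nonempty | move=> t [/ltW]]. Qed.

Lemma operator_norm_le a t : bounds a t -> operator_norm a <= t.
Proof.
by move=> at_; apply: ge_inf => //; exists 0 => s [/ltW].
Qed.

Lemma le_operator_norm a s : (forall t, bounds a t -> s <= t) ->
  s <= operator_norm a.
Proof. by move=> sle; apply: lb_le_inf => //; exact: bounds_nonempty. Qed.

Lemma operator_norm_eq0 a : operator_norm a = 0 -> a = 0.
Proof.
move=> a0; apply: (bounded_by_eq0 algA eig) => z z0.
have zE : z = (complex.Re z)%:C%C by rewrite RRe_real // gtr0_real.
have z0' : 0 < complex.Re z by rewrite -ltcR -zE.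
have [t [t0 at_] tz] : exists2 t, bounds a t & t < complex.Re z.
  by apply: inf_lt; [exact: bounds_nonempty | rewrite -/(operator_norm a) a0].
apply: (bounded_byW algA eig _ _ at_).
  by rewrite lecR ltW.
by rewrite zE lecR ltW.
Qed.

Lemma operator_normD a b :
  operator_norm (a + b) <= operator_norm a + operator_norm b.
Proof.
rewrite -lerBlDr; apply: le_operator_norm => s [s0 sa].
rewrite lerBlDr -lerBlDl; apply: le_operator_norm => t [t0 tb].
rewrite lerBlDl; apply: operator_norm_le; split; first exact: addr_gt0.
by rewrite rmorphD; apply: bounded_byD; rewrite ?ltcR.
Qed.

(** For [x = 0] the reason is that [a] has at least one bound. *)
Lemma le_pmul_norm (x : R) a (y : R) : 0 <= x ->
  (forall t, bounds a t -> y <= x * t) -> y <= x * operator_norm a.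
Proof.
rewrite le_eqVlt => /orP[/eqP <-|x0] yle.
  have [t at_] := bounds_nonempty a.
  by rewrite mul0r; have := yle t at_; rewrite mul0r.
rewrite -ler_pdivrMl //; apply: le_operator_norm => t /yle.
by rewrite ler_pdivrMl.
Qed.

Lemma operator_normM a b :
  operator_norm (a ** b) <= operator_norm a * operator_norm b.
Proof.
apply: le_pmul_norm => [|t [t0 tb]]; first exact: operator_norm_ge0.
rewrite mulrC; apply: le_pmul_norm => [|s [s0 sa]]; first exact: ltW.
rewrite mulrC; apply: operator_norm_le; split; first exact: mulr_gt0.
by rewrite rmorphM; apply: bounded_byM; rewrite ?lecR ?ltW.
Qed.

Lemma normc_ge0 (l : R[i]) : 0 <= Normc.normc l.
Proof. by case: l => x y; exact: sqrtr_ge0. Qed.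

Lemma normc_gt0 (l : R[i]) : l != 0 -> 0 < Normc.normc l.
Proof.
move=> l0; rewrite lt_neqAle normc_ge0 andbT eq_sym.
by apply: contra_neq l0 => /Normc.eq0_normc.
Qed.

Lemma operator_normZ_le (l : R[i]) a :
  operator_norm (l *: a) <= Normc.normc l * operator_norm a.
Proof.
apply: le_pmul_norm => [|t [t0 ta]].
  exact: normc_ge0.
have [->|l0] := eqVneq l 0.
  rewrite scale0r Normc.normc0 mul0r; apply/ler_addgt0Pr => s s0; rewrite add0r.
  by apply: operator_norm_le; split=> //; apply: bounded_by0 => //;
    rewrite lecR ltW.
apply: operator_norm_le; split; first by rewrite mulr_gt0 ?normc_gt0.
by rewrite rmorphM; exact: bounded_byZ.
Qed.

Lemma operator_normZ (l : R[i]) a :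
  operator_norm (l *: a) = Normc.normc l * operator_norm a.
Proof.
apply/eqP; rewrite eq_le operator_normZ_le /=.
have [->|l0] := eqVneq l 0.
  by rewrite Normc.normc0 mul0r operator_norm_ge0.
have n0 := normc_gt0 l0.
rewrite -ler_pdivlMl // -Normc.normcV.
have := operator_normZ_le l^-1 (l *: a).
by rewrite scalerA mulVf // scale1r.
Qed.

Lemma operator_norm_sqr_le a :
  operator_norm a ^+ 2 <= operator_norm (star a ** a).
Proof.
apply: le_operator_norm => t [t0 ta].
have t0' : 0 < t%:C%C by rewrite ltcR.
have sE : (Num.sqrt t)%:C%C = sqrtC t%:C%C.
  apply/eqP; rewrite -(eqrXn2 (n := 2)) ?sqrtC_ge0 ?lecR ?sqrtr_ge0 ?ltW //.
  by rewrite sqrtCK -rmorphXn sqr_sqrtr // ltW.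
have : operator_norm a <= Num.sqrt t.
  apply: operator_norm_le; split; first by rewrite sqrtr_gt0.
  by rewrite sE; exact: bounded_by_starM.
rewrite -(ler_pXn2r (n := 2)) ?nnegrE ?operator_norm_ge0 ?sqrtr_ge0 //.
by rewrite sqr_sqrtr // ltW.
Qed.

(** [|a|^2 <= |a^* a| <= |a^*| |a|]. *)
Lemma operator_norm_star_le a : operator_norm a <= operator_norm (star a).
Proof.
have := le_trans (operator_norm_sqr_le a) (operator_normM _ _).
have := operator_norm_ge0 a; rewrite le_eqVlt => /orP[/eqP <- _|a0].
  exact: operator_norm_ge0.
by rewrite expr2 ler_pM2r.
Qed.

Lemma operator_norm_Cstar : pre_Cstar_norm operator_norm.
Proof.
split; [exact: operator_norm_ge0 | exact: operator_norm_eq0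
  | exact: operator_normD | exact: operator_normZ | exact: operator_normM |].
move=> a; apply/eqP; rewrite eq_le operator_norm_sqr_le andbT.
apply: (le_trans (operator_normM _ _)); rewrite expr2.
apply: ler_wpM2r; first exact: operator_norm_ge0.
by have := operator_norm_star_le (star a); rewrite starK.
Qed.

End OperatorNorm.

(** * The equivalence *)

Lemma pre_Cstar_proper (R : realType) (A : starAlgType R[i]) (sigma : A -> R) :
  pre_Cstar_norm sigma -> proper_involution A.
Proof.
move=> [_ s0 _ sZ _ sC] a aa0; apply: s0; apply/eqP.
by rewrite -sqrf_eq0 -sC aa0 -(scale0r (0 : A)) sZ Normc.normc0 mul0r.
Qed.

Lemma spectral_theoremP (R : realType) (A : starAlgType R[i]) :
  spectral_theorem A <->
  forall b : A, b != 0 -> selfadjoint b -> real_combination_of_projections b.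
Proof.
split=> [spec b _ bb|comb_b b bb].
  have [n [lam [e [[lam_inj lamR] [pr or] e0 bE]]]] := spec b bb.
  have lamE j : (complex.Re (lam j))%:C%C = lam j.
    by rewrite RRe_real //; exact: (lamR j).1.
  exists n, (fun j => complex.Re (lam j)), e; split=> //.
  - split=> [i j ij|j]; first by apply: lam_inj; rewrite -lamE ij lamE.
    by have [_] := lamR j; apply: contra_neq => l0; rewrite -lamE l0.
  - by rewrite bE; apply: eq_bigr => j _; rewrite lamE.
have [->|/comb_b/(_ bb)] := eqVneq b 0.
  exists 0, (fun=> 0), (fun=> 0); split=> //; try by case.
  - by split; case.
  - by split; case.
  - by rewrite /comb big_ord0.
move=> [n [lam [e [[lam_inj lam0] pr or bE]]]].
exists n, (fun j => (lam j)%:C%C), e; split=> //.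
- split=> [i j [/lam_inj //]|j]; split.
  by rewrite realE (lecR 0) (lecR _ 0) -realE num_real.
  by rewrite fmorph_eq0.
- by split=> // j; have [] := pr j.
- by move=> j; have [] := pr j.
Qed.

Theorem theorem2p3 (R : realType) (A : starAlgType R[i]) (hA : algebraic A) :
  [<-> exists sigma : A -> R, pre_Cstar_norm sigma;
       proper_involution A;
       hermitian_algebra A /\ semisimple A;
       forall b : A, b != 0 -> selfadjoint b ->
         real_combination_of_projections b;
       weakly_rickart A;
       hermitian_algebra A /\ von_neumann_regular A].
Proof.
have proper_spectral : proper_involution A -> spectral_theorem A.
  by move=> prA; exact/eigen_spectral_theorem/proper_eigenprojections.
tfae.
- by move=> [sigma]; exact: pre_Cstar_proper.
- move=> /proper_spectral spec.
  by split; [exact: spectral_hermitian | exact: spectral_semisimple].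
- move=> [herA ssA]; apply/spectral_theoremP/proper_spectral.
  exact: hermitian_semisimple_proper.
- by move/spectral_theoremP; exact: spectral_weakly_rickart.
- move=> /weakly_rickart_proper/proper_spectral spec.
  by split; [exact: spectral_hermitian | exact: spectral_regular].
- move=> [herA vnA]; exists (@operator_norm R A);
  apply: operator_norm_Cstar => //.
  by apply: proper_eigenprojections => //; exact: hermitian_regular_proper.
Qed.
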